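(* Let $G$ be a countable abelian group and suppose $(X,\mu)$ is an ergodic $G$-space. Let $A\subset G$ and suppose $B\subset X$ is a measurable subset such that $$\mu(AB)\le K\cdot\mu(B)$$ for some $K$. Then $$d^*(A^k)\le K^k\cdot\mu(B)$$ for every integer $k\ge 1$. In particular, $$\mu(AB)\ge d^*(A^k)^{\frac1k}\cdot\mu(B)^{1-\frac1k}$$ for all $k\ge 1$.
   Context: A $G$-space $(X,\mu)$ is a probability measure space such that the Hilbert space $L^2(X,\mu)$ is separable, on which $G$ acts by bi-measurable bijections which preserve $\mu$. It is ergodic if there is no $G$-invariant measurable set $B\subset X$ with $0<\mu(B)<1$. For $A\subset G$ and measurable $B\subset X$, $AB=\bigcup_{a\in A}aB$. $A^k$ denotes the $k$-fold product set of $A$ with itself. A mean on $G$ is a positive norm-one linear functional on $\ell^\infty(G)$; for a mean $\lambda$ put $\lambda'(C)=\lambda(\chi_C)$, $C\subset G$, where $\chi_C$ is the indicator function of $C$. $\mathcal{L}_G$ is the set of all translation-invariant means on $G$. The upper Banach density of $C\subset G$ is $d^*(C)=\sup_{\lambda\in\mathcal{L}_G}\lambda'(C)$.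
   Formalization: The formal theorem adds the hypothesis μ(B) > 0, which the claim needs: for A = G and B empty, μ(AB) ≤ K·μ(B) holds for every K, while d*(A^k) = 1 > 0 = K^k·μ(B). *)

(* Defs.v *)
From HB Require Import structures.
From mathcomp Require Import all_boot all_order all_algebra.
From mathcomp Require Import all_classical all_reals all_analysis.

Set Implicit Arguments.
Unset Strict Implicit.
Unset Printing Implicit Defensive.

Import Order.TTheory GRing.Theory Num.Theory.
Import numFieldNormedType.Exports.

Local Open Scope classical_set_scope.
Local Open Scope ring_scope.

(* Abelian groups are zmodTypes, hence written additively: the product set
   A^k is the k-fold sumset of A. *)

Section Linf.
Context (G : Type) (R : realType).

Definition bounded_pred : {pred G -> R} := mem [set f : G -> R | bounded_fun f].

Lemma bounded_predP (f : G -> R) :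
  reflect (exists M, forall x, `|f x| <= M) (f \in bounded_pred).
Proof.
apply: (iffP idP) => [/set_mem[M [_ hM]]|[M hM]].
  by exists (M + 1) => x; apply: hM => //; rewrite ltrDl.
apply/mem_set; exists M; split; first exact: num_real.
by move=> N MN x _; exact: le_trans (hM x) (ltW MN).
Qed.

Lemma bounded_submod_closed : submod_closed bounded_pred.
Proof.
split; first by apply/bounded_predP; exists 0 => x; rewrite normr0.
move=> a f g /bounded_predP[M hM] /bounded_predP[N hN].
apply/bounded_predP; exists (`|a| * M + N) => x.
by rewrite (le_trans (ler_normD _ _))// lerD// normrM ler_wpM2l.
Qed.

HB.instance Definition _ := GRing.isSubmodClosed.Build R (G -> R) bounded_pred
  bounded_submod_closed.

(* The space of bounded real-valued functions on G. *)
Record linf := Linf {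
  linf_val :> G -> R;
  linf_valP : linf_val \in bounded_pred }.

HB.instance Definition _ := [isSub for linf_val].
HB.instance Definition _ := [Choice of linf by <:].
HB.instance Definition _ := [SubChoice_isSubLmodule of linf by <:].

Definition linf_norm (f : linf) : R := sup [set `|f x| | x in [set: G]].

Lemma indic_bounded (C : set G) : (\1_C : G -> R) \in bounded_pred.
Proof.
by apply/bounded_predP; exists 1 => x; rewrite indicE normr_nat lern1 leq_b1.
Qed.

Definition linf_indic (C : set G) : linf := Linf (indic_bounded C).

(* The operator norm; possibly +oo, as l is an arbitrary linear form. *)
Definition opnorm (l : {scalar linf}) : \bar R :=
  ereal_sup [set (`|l f|)%:E | f in [set f : linf | linf_norm f <= 1]].

Definition is_mean (l : {scalar linf}) : Prop :=
  (forall f : linf, (forall x, 0 <= f x) -> 0 <= l f) /\ opnorm l = 1%E.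

Definition mean_set (l : {scalar linf}) (C : set G) : R := l (linf_indic C).

End Linf.

Section Density.
Context (G : zmodType) (R : realType).

Lemma translate_bounded (g : G) (f : linf G R) :
  (fun x => f (g + x)) \in @bounded_pred G R.
Proof.
have /bounded_predP[M hM] := linf_valP f.
by apply/bounded_predP; exists M => x; exact: hM.
Qed.

Definition translate (g : G) (f : linf G R) : linf G R :=
  Linf (translate_bounded g f).

Definition invariant_means : set {scalar (linf G R)} :=
  [set l | is_mean l /\ forall g f, l (translate g f) = l f].

Definition upper_banach_density (C : set G) : R :=
  sup [set mean_set l C | l in invariant_means].

End Density.

Fixpoint sumset_pow (G : zmodType) (A : set G) (k : nat) : set G :=
  if k is k'.+1 then [set a + b | a in A & b in sumset_pow A k'] else [set 0].

Section GSpace.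
Context (G : zmodType) (d : measure_display) (X : measurableType d)
  (R : realType) (P : probability X R).

(* Density in the L^2 seminorm of a countable set of square-integrable
   functions, i.e. density of the set of their classes in L^2(X, P). *)
Definition L2_separable : Prop :=
  exists2 D : set (LfunType P (lee1n 2)), countable D &
    forall (f : LfunType P (lee1n 2)) (e : R), 0 < e ->
      exists2 g, D g & ('N[P]_2%:E[EFin \o (f \- g)%R] < e%:E)%E.

(* By gspace0 and gspaceD the inverse of act g is act (- g), so each act g is
   a bi-measurable bijection. *)
Record is_gspace (act : G -> X -> X) : Prop := {
  gspace_separable : L2_separable;
  gspace0 : forall x, act 0 x = x;
  gspaceD : forall g h x, act (g + h) x = act g (act h x);
  gspace_measurable : forall g, measurable_fun [set: X] (act g);
  gspace_preserving : forall g B, measurable B -> P (act g @` B) = P B }.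

Definition ergodic (act : G -> X -> X) : Prop :=
  ~ exists B : set X, [/\ measurable B,
      forall g, act g @` B = B & (0 < P B < 1)%E].

Definition act_set (act : G -> X -> X) (A : set G) (B : set X) : set X :=
  \bigcup_(a in A) (act a @` B).

End GSpace.

(* Main.v *)
Require Import Defs.
From HB Require Import structures.
From mathcomp Require Import all_boot all_order all_algebra.
From mathcomp Require Import all_classical all_reals all_analysis.
From mathcomp Require Import ring lra.

(** Write A S for the union of the translates a S, a in A. The theorem combines
    an upper bound for P (A^k S) and a lower bound for it, for one well chosen
    set S inside B, of positive measure.

    Upper bound. Petridis' proof of the Pluennecke inequality works with a
    subset S of B that minimizes the ratio P (A S) / P S. On a probability
    space this infimum may only be approached by sets of vanishing measure.
    The difference P (A S) - K P S is minimized instead: it is submodular, so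
    unions of near-minimizers are near-minimizers ([near_minimizer_bigcup]),
    and the upper limit of a fast enough sequence of near-minimizers is a
    minimizer ([submodular_min]). Minimality of the difference is what the
    inductive step of Petridis uses ([plunnecke_step]); it gives
    P (C A S) <= K P (C S) for all subsets C of G ([plunnecke_petridis]), hence
    P (A^k S) <= K^k P S <= K^k P B ([plunnecke_pow]).

    Lower bound. If P S > 0, then d*(C) <= P (C S) for every subset C of G
    ([upper_banach_density_le]). Let E be the complement of C S and let l be an
    invariant mean. By ergodicity the mean of g |-> P (g S inter E) is at least
    P S * P E times the mass of l ([mean_overlap_ge]), while the function
    vanishes on C and is at most P S elsewhere; comparing the two yields
    l(C) <= P (C S). The ergodic statement comes from the same variational
    principle: the defect of the inequality, as a function of S, is modular and
    invariant, so a countable union of translates of a minimizer is again a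
    minimizer. This union is an invariant set, thus null or conull, and there
    the defect is nonnegative.

    The second inequality of the theorem is the first with K = P (A B) / P B,
    after extracting k-th roots. *)

Set Implicit Arguments.
Unset Strict Implicit.
Unset Printing Implicit Defensive.

Import Order.TTheory GRing.Theory Num.Theory.
Import numFieldNormedType.Exports.

Local Open Scope classical_set_scope.
Local Open Scope ring_scope.

(** * Minimizing submodular set functions *)

(** Semicontinuity is expressed through sublevel sets: they are stable under
    monotone limits. The domain [M] belongs to the structure, so that each of
    these limits stays in it. *)
Record submodular_lsc (R : realType) (T : Type) (M : set (set T))
    (F : set T -> R) : Prop := {
  slscU : forall S S', M S -> M S' -> M (S `|` S');
  slscI : forall S S', M S -> M S' -> M (S `&` S');
  slsc_submod : forall S S', M S -> M S' ->
    F (S `|` S') + F (S `&` S') <= F S + F S';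
  slsc_nondecreasing : forall (S : (set T)^nat) (b : R),
    (forall n, M (S n)) -> nondecreasing_seq S -> (forall n, F (S n) <= b) ->
    M (\bigcup_n S n) /\ F (\bigcup_n S n) <= b;
  slsc_nonincreasing : forall (S : (set T)^nat) (b : R),
    (forall n, M (S n)) -> nonincreasing_seq S -> (forall n, F (S n) <= b) ->
    M (\bigcap_n S n) /\ F (\bigcap_n S n) <= b }.

Section SubmodularMin.
Context (R : realType) (T : Type) (M : set (set T)) (F : set T -> R)
  (MF : submodular_lsc M F).

(** The errors of near-minimizers add up under unions: by submodularity,
    F (D union S) <= F D + F S - F (D inter S), and the subtracted term is at
    least the lower bound [m]. *)
Lemma near_minimizer_bigcup (m E : R) (e : R^nat) (S : (set T)^nat) :
  (forall S', M S' -> m <= F S') -> (forall n, M (S n)) ->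
  (forall n, F (S n) <= m + e n) ->
  (forall n, \sum_(i < n) e i <= E) ->
  M (\bigcup_n S n) /\ F (\bigcup_n S n) <= m + E.
Proof.
move=> lb MS Se sume.
pose D n := \big[setU/set0]_(i < n.+1) S i.
have DM n : M (D n).
  by elim: n => [|n IH]; rewrite /D ?big_ord1// big_ord_recr; exact: (slscU MF).
have De n : F (D n) <= m + \sum_(i < n.+1) e i.
  elim: n => [|n IH]; first by rewrite /D !big_ord1.
  rewrite /D big_ord_recr /= -/(D n).
  have := slsc_submod MF (DM n) (MS n.+1).
  have := lb _ (slscI MF (DM n) (MS n.+1)).
  have := Se n.+1.
  rewrite [\sum_(i < n.+2) e i]big_ord_recr /=.
  lra.
have homoD : nondecreasing_seq D.
  by move=> i j ij; apply/subsetPset; exact: subset_bigsetU.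
rewrite -(bigcup_bigsetU_bigcup S).
apply: (slsc_nondecreasing MF) => // n.
by apply: le_trans (De n) _; rewrite lerD2l.
Qed.

(** The minimum is attained at the upper limit of sets whose errors are
    summable. *)
Lemma submodular_min : M !=set0 -> (exists a, forall S, M S -> a <= F S) ->
  exists2 S, M S & forall S', M S' -> F S <= F S'.
Proof.
move=> [S0 MS0] [a aF]; pose m := inf [set F S | S in M].
have hi : has_inf [set F S | S in M].
  by split; [exists (F S0), S0|exists a => _ [S MS <-]; exact: aF].
have mF S : M S -> m <= F S.
  by move=> MS; apply: ge_inf; [exact: hi.2|by exists S].
pose e n : R := 2^-1 ^+ n.
have e0 n : 0 < e n by rewrite exprn_gt0// invr_gt0 ltr0n.
have eS n : e n = e n.+1 + e n.+1 by rewrite /e exprS; field.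
have /choice[S hS] n : exists S, M S /\ F S <= m + e n.+1.
  have [_ [S MS <-] /ltW ?] := inf_adherent (e0 n.+1) hi.
  by exists S.
pose D N := \bigcup_n S (N + n)%N.
have hD N : M (D N) /\ F (D N) <= m + e N.
  apply: (near_minimizer_bigcup (e := fun n => e (N + n).+1)) => //.
  - by move=> n; exact: (hS _).1.
  - by move=> n; exact: (hS _).2.
  move=> n; suff -> : \sum_(i < n) e (N + i).+1 = e N - e (N + n)%N.
    by rewrite gerBl ltW.
  elim: n => [|n IH]; first by rewrite big_ord0 addn0 subrr.
  by rewrite big_ord_recr /= IH addnS (eS (N + n)%N); ring.
have homoD : nonincreasing_seq D.
  move=> i j ij; apply/subsetPset => x [n _ Sx].
  by exists (j - i + n)%N => //; rewrite addnA subnKC.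
have hB k : M (\bigcap_N D N) /\ F (\bigcap_N D N) <= m + e k.
  (* Dropping the first k sets improves the common bound to m + e k. *)
  have -> : \bigcap_N D N = \bigcap_N D (k + N)%N.
    apply/seteqP; split => x Dx N _; first exact: Dx.
    by move: (homoD N (k + N)%N (leq_addl _ _)) => /subsetPset; apply; exact: Dx.
  apply: (slsc_nonincreasing MF) => [n|i j ij|n]; first exact: (hD _).1.
    by apply: homoD; rewrite leq_add2l.
  apply: le_trans (hD _).2 _; rewrite lerD2l /e exprD ler_piMr ?exprn_ge0//.
  by rewrite exprn_ile1// invf_le1// ler1n.
exists (\bigcap_N D N); first exact: (hB 0).1.
move=> S' /mF; apply: le_trans.
have ecvg : (m + e k) @[k --> \oo] --> m + 0.
  apply: cvgD; first exact: cvg_cst.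
  by apply: cvg_expr; rewrite ger0_norm ?invf_lt1 ?ltr1n.
rewrite -[m in leRHS]addr0; apply: cvgr_to_ge ecvg _.
by apply: nearW => k; exact: (hB k).2.
Qed.

End SubmodularMin.

(** * Real-valued probabilities *)

Section Pmass.
Context (d : measure_display) (X : measurableType d) (R : realType)
  (P : probability X R).
Implicit Types S : set X.

Definition pmass S : R := fine (P S).

Lemma pmassE S : measurable S -> P S = (pmass S)%:E.
Proof. by move=> mS; rewrite fineK// fin_num_measure. Qed.

Lemma pmass_ge0 S : 0 <= pmass S.
Proof. exact: fine_ge0. Qed.

Lemma pmass0 : pmass set0 = 0.
Proof. by rewrite /pmass measure0. Qed.

Lemma pmassT : pmass [set: X] = 1.
Proof. by rewrite /pmass probability_setT. Qed.

Lemma le_pmass S S' : measurable S -> measurable S' -> S `<=` S' ->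
  pmass S <= pmass S'.
Proof.
by move=> mS mS' SS'; rewrite -lee_fin -!pmassE// le_measure// inE.
Qed.

Lemma pmass_le1 S : measurable S -> pmass S <= 1.
Proof. by move=> mS; rewrite -lee_fin -pmassE// probability_le1. Qed.

Lemma pmassUI S S' : measurable S -> measurable S' ->
  pmass (S `|` S') + pmass (S `&` S') = pmass S + pmass S'.
Proof.
move=> mS mS'; have mU := measurableU _ _ mS mS'.
have mI := measurableI _ _ mS mS'.
have : P (S `|` S') = (P S + P S' - P (S `&` S'))%E.
  by apply: (measureUfinl mS mS'); rewrite -ge0_fin_numE ?fin_num_measure.
by rewrite !pmassE// => -[->]; rewrite subrK.
Qed.

Lemma pmassC S : measurable S -> pmass (~` S) = 1 - pmass S.
Proof.
move=> mS; have := pmassUI mS (measurableC mS).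
by rewrite setUv setICr pmass0 pmassT; lra.
Qed.

Lemma pmass_bigcup_cvg (S : (set X)^nat) : (forall n, measurable (S n)) ->
  nondecreasing_seq S -> pmass (S n) @[n --> \oo] --> pmass (\bigcup_n S n).
Proof.
move=> mS ndS; have mU := bigcupT_measurable _ mS.
suff /fine_cvgP[] : P (S n) @[n --> \oo] --> (pmass (\bigcup_n S n))%:E by [].
by rewrite -pmassE//; exact: (nondecreasing_cvg_mu mS mU ndS).
Qed.

Lemma pmass_bigcap_cvg (S : (set X)^nat) : (forall n, measurable (S n)) ->
  nonincreasing_seq S -> pmass (S n) @[n --> \oo] --> pmass (\bigcap_n S n).
Proof.
move=> mS niS; have mI := bigcapT_measurable mS.
have fin0 : (P (S 0%N) < +oo)%E by rewrite -ge0_fin_numE ?fin_num_measure.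
suff /fine_cvgP[] : P (S n) @[n --> \oo] --> (pmass (\bigcap_n S n))%:E by [].
by rewrite -pmassE//; exact: (nonincreasing_cvg_mu fin0 mS mI niS).
Qed.

End Pmass.

(** * Translates of sets *)

Lemma countable_enumeration (T : choiceType) (x0 : T) :
  countable [set: T] -> exists e : nat -> T, forall x, exists n, e n = x.
Proof.
move=> /countable_injP[f fI].
exists (fun n => xget x0 [set x | f x = n]) => x; exists (f x).
have := @xgetPex _ x0 [set y | f y = f x] (ex_intro _ x erefl).
by apply: fI; rewrite inE.
Qed.

Section ActSet.
Context (G : zmodType) (d : measure_display) (X : measurableType d)
  (act : G -> X -> X).
Implicit Types (A C : set G) (S : set X).

Lemma sub_act_set A S S' : S `<=` S' -> act_set act A S `<=` act_set act A S'.
Proof. by move=> SS'; apply: subset_bigcup => a _; exact: image_subset. Qed.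

Lemma act_set0 S : act_set act set0 S = set0.
Proof. exact: bigcup_set0. Qed.

Lemma act_set1 a S : act_set act [set a] S = act a @` S.
Proof. exact: bigcup_set1. Qed.

Lemma act_setUl C C' S :
  act_set act (C `|` C') S = act_set act C S `|` act_set act C' S.
Proof. exact: bigcup_setU. Qed.

Lemma act_setUr A S S' :
  act_set act A (S `|` S') = act_set act A S `|` act_set act A S'.
Proof.
by rewrite /act_set -bigcupU; apply: eq_bigcupr => a _; rewrite image_setU.
Qed.

Lemma act_set_bigcup A (S : (set X)^nat) :
  act_set act A (\bigcup_n S n) = \bigcup_n act_set act A (S n).
Proof.
rewrite /act_set; apply/seteqP; split.
  by move=> _ [a Aa [x [n _ Snx] <-]]; exists n => //; exists a => //; exists x.
by move=> _ [n _ [a Aa [x Snx <-]]]; exists a => //; exists x => //; exists n.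
Qed.

Context (actD : forall g h x, act (g + h) x = act g (act h x)).

(** The only place, together with the invariance of [mean_overlap], where
    commutativity of the group enters. *)
Lemma act_setC A C S :
  act_set act A (act_set act C S) = act_set act C (act_set act A S).
Proof.
suff H A' C' : act_set act A' (act_set act C' S) `<=`
    act_set act C' (act_set act A' S) by apply/seteqP; split; exact: H.
move=> _ [a Aa [_ [c Cc [x Sx <-]] <-]]; exists c => //; exists (act a x).
  by exists a => //; exists x.
by rewrite -!actD addrC.
Qed.

Lemma act_set_sumset A C S :
  act_set act [set a + c | a in A & c in C] S = act_set act A (act_set act C S).
Proof.
apply/seteqP; split.
  move=> _ [_ [a Aa [c Cc <-]] [x Sx <-]].
  exists a => //; rewrite actD; exists (act c x) => //.
  by exists c => //; exists x.
move=> _ [a Aa [_ [c Cc [x Sx <-]] <-]]; exists (a + c).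
  by exists a => //; exists c.
by exists x; rewrite ?actD.
Qed.

Context (act0 : forall x, act 0 x = x).

Lemma act_imageE g S : act g @` S = act (- g) @^-1` S.
Proof.
apply/seteqP; split => [_ [x Sx <-]|x Sx] /=.
  by rewrite -actD addNr act0.
by exists (act (- g) x) => //; rewrite -actD subrr act0.
Qed.

End ActSet.

Section Plunnecke.
Context (R : realType) (G : zmodType) (d : measure_display)
  (X : measurableType d) (P : probability X R) (act : G -> X -> X)
  (cG : countable [set: G]) (hact : is_gspace P act).
Let act0 := gspace0 hact.
Let actD := gspaceD hact.
Local Notation "A ** S" := (act_set act A S) (at level 40, left associativity).
Local Notation p := (pmass P).
Implicit Types (A C : set G) (S B : set X).

Lemma act_image_measurable g S : measurable S -> measurable (act g @` S).
Proof.
move=> mS; rewrite act_imageE// -[_ @^-1` _]setTI.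
exact: (gspace_measurable hact (- g) measurableT).
Qed.

Lemma pmass_act g S : measurable S -> p (act g @` S) = p S.
Proof. by move=> mS; rewrite /pmass (gspace_preserving hact). Qed.

Lemma act_set_measurable A S : measurable S -> measurable (A ** S).
Proof.
move=> mS; rewrite /act_set bigcup_mkcond.
apply: countable_bigcupT_measurable => // g.
by case: ifP => _ //; exact: act_image_measurable.
Qed.

(** * The Pluennecke inequality *)

Definition excess A (K : R) S : R := p (A ** S) - K * p S.

(** The term P (A S) is submodular since A (S inter S') is contained in
    A S inter A S'. It commutes with increasing unions; along a decreasing
    sequence only monotonicity is available, which is the direction wanted. *)
Lemma excess_submodular_lsc A K B : measurable B ->
  submodular_lsc [set S | measurable S /\ S `<=` B] (excess A K).
Proof.
move=> mB; split.
- by move=> S S' [mS SB] [mS' SB']; split; [exact: measurableU|rewrite subUset].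
- move=> S S' [mS SB] [mS' SB']; split; first exact: measurableI.
  by move=> x [Sx _]; exact: SB.
- move=> S S' [mS _] [mS' _]; rewrite /excess.
  have mAS := act_set_measurable A mS; have mAS' := act_set_measurable A mS'.
  have := pmassUI P mS mS'; have := pmassUI P mAS mAS'.
  rewrite act_setUr.
  have : p (A ** (S `&` S')) <= p ((A ** S) `&` (A ** S')).
    apply: le_pmass; [|exact: measurableI|].
      exact/act_set_measurable/measurableI.
    rewrite subsetI; split; apply: sub_act_set; first exact: subIsetl.
    exact: subIsetr.
  nra.
- move=> S b MS ndS hb; have mS n := (MS n).1.
  split.
    by split; [exact: bigcupT_measurable|apply: bigcup_sub => n _; case: (MS n)].
  rewrite /excess lerBlDr act_set_bigcup.
  have mAS n := act_set_measurable A (mS n).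
  have c1 : p (A ** S n) @[n --> \oo] --> p (\bigcup_n A ** S n).
    apply: pmass_bigcup_cvg => // i j ij.
    by apply/subsetPset/sub_act_set/subsetPset; exact: ndS.
  have c2 : b + K * p (S n) @[n --> \oo] --> b + K * p (\bigcup_n S n).
    by apply: cvgD; [exact: cvg_cst|apply: cvgMl_tmp; exact: pmass_bigcup_cvg].
  by apply: ler_cvg_to c1 c2 _; apply: nearW => n; rewrite -lerBlDr; exact: hb.
- move=> S b MS niS hb; have mS n := (MS n).1.
  have mI : measurable (\bigcap_n S n) by exact: bigcapT_measurable.
  split; first by split => //; apply: subset_trans (MS 0%N).2; exact: bigcap_inf.
  rewrite /excess lerBlDr.
  have c2 : b + K * p (S n) @[n --> \oo] --> b + K * p (\bigcap_n S n).
    by apply: cvgD; [exact: cvg_cst|apply: cvgMl_tmp; exact: pmass_bigcap_cvg].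
  apply: cvgr_to_ge c2 _; apply: nearW => n; rewrite -lerBlDr.
  apply: le_trans (hb n); rewrite lerD2r; apply: le_pmass.
  + exact: act_set_measurable.
  + exact: act_set_measurable.
  + by apply: sub_act_set; exact: bigcap_inf.
Qed.

(** A minimizer has nonpositive excess. If it is null, its excess is zero; then
    [B], whose excess is nonpositive, is a minimizer as well. *)
Lemma exists_excess_minimizer A (K : R) B : 0 <= K -> measurable B ->
  0 < p B -> p (A ** B) <= K * p B ->
  exists S, [/\ measurable S, S `<=` B, 0 < p S &
    forall S', measurable S' -> S' `<=` B -> excess A K S <= excess A K S'].
Proof.
move=> K0 mB pB hB.
have [||S [mS SB] minS] := submodular_min (excess_submodular_lsc A K mB).
- by exists B; split.
- exists (- K) => S [mS _]; rewrite /excess.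
  have := pmass_ge0 P (A ** S); have := pmass_le1 P mS; nra.
have SleB : excess A K S <= excess A K B by apply: minS; split.
have B0 : excess A K B <= 0 by rewrite /excess subr_le0.
have [pS|pS] := ltP 0 (p S).
  by exists S; split => // S' mS' S'B; apply: minS.
exists B; split => // S' mS' S'B; apply: le_trans B0 _.
apply: le_trans (minS S' (conj mS' S'B)); rewrite /excess.
have := pmass_ge0 P (A ** S); have := pmass_ge0 P S; nra.
Qed.

(** Adding c to C replaces C S by its union with c S. The overlap of c S with
    C S is c F for some subset F of S, and since the group is commutative the
    overlap of c A S with C A S contains c A F. So the left-hand side grows by
    at most P (A S) - P (A F) and the right-hand side by K (P S - P F);
    minimality of S against F compares the two. *)
Lemma plunnecke_step A (K : R) S C c : measurable S ->
  (forall S', measurable S' -> S' `<=` S -> excess A K S <= excess A K S') ->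
  p (C ** (A ** S)) <= K * p (C ** S) ->
  p ((C `|` [set c]) ** (A ** S)) <= K * p ((C `|` [set c]) ** S).
Proof.
move=> mS minS IH; have mAS := act_set_measurable A mS.
have mCS := act_set_measurable C mS; have mCAS := act_set_measurable C mAS.
have mcS := act_image_measurable c mS; have mcAS := act_image_measurable c mAS.
pose F := S `&` act (- c) @` (C ** S).
have mF : measurable F by apply: measurableI => //; exact: act_image_measurable.
have cF : act c @` F = (C ** S) `&` (act c @` S).
  apply/seteqP; split=> [_ [x [Sx [y Cy yx]] <-]|z [Cz [x Sx xz]]].
    split; last by exists x.
    by rewrite -yx -actD subrr act0.
  exists x => //; split => //; exists (act c x); first by rewrite xz.
  by rewrite -actD addNr act0.
have mAF := act_set_measurable A mF.
have cAF : act c @` (A ** F) `<=` (C ** (A ** S)) `&` (act c @` (A ** S)).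
  have actA T : act c @` (A ** T) = A ** (act c @` T).
    by rewrite -!act_set1 act_setC.
  rewrite !actA cF act_setC// subsetI; split; apply: sub_act_set.
    exact: subIsetl.
  exact: subIsetr.
have := minS F mF (@subIsetl _ _ _).
have := le_pmass P (act_image_measurable c mAF) (measurableI _ _ mCAS mcAS) cAF.
have := pmassUI P mCAS mcAS; have := pmassUI P mCS mcS.
rewrite -cF !act_setUl !act_set1 !pmass_act// /excess => e1 e2 h1 h2.
have -> : p ((C ** S) `|` (act c @` S)) = p (C ** S) + p S - p F by lra.
lra.
Qed.

Lemma act_set_cvg (e : nat -> G) C S : (forall g, exists n, e n = g) ->
  measurable S ->
  p ((C `&` [set e i | i in `I_n]) ** S) @[n --> \oo] --> p (C ** S).
Proof.
move=> he mS.
have -> : C ** S = \bigcup_n ((C `&` [set e i | i in `I_n]) ** S).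
  apply/seteqP; split=> [_ [c Cc [x Sx <-]]|_ [n _ [c [Cc _] [x Sx <-]]]].
    have [n en] := he c; exists n.+1 => //.
    by exists c; [split => //; exists n => /=|exists x].
  by exists c => //; exists x.
apply: pmass_bigcup_cvg => [n|i j ij]; first exact: act_set_measurable.
apply/subsetPset => x [c [Cc [k ki kc]] cSx]; exists c => //; split => //.
by exists k => //; exact: leq_trans ij.
Qed.

(** Finite sets C are handled one element at a time; an infinite C is exhausted
    by finite sets, with no loss since the minimizer does not depend on C. *)
Lemma plunnecke_petridis A (K : R) S : measurable S ->
  (forall S', measurable S' -> S' `<=` S -> excess A K S <= excess A K S') ->
  forall C, p (C ** (A ** S)) <= K * p (C ** S).
Proof.
move=> mS minS C; have [e he] := countable_enumeration 0 cG.
have mAS := act_set_measurable A mS.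
have c1 := act_set_cvg (C := C) he mAS.
have c2 : K * p ((C `&` [set e i | i in `I_n]) ** S) @[n --> \oo] -->
    K * p (C ** S) by apply: cvgMl_tmp; exact: act_set_cvg.
apply: ler_cvg_to c1 c2 _; apply: nearW; elim => [|n IH].
  by rewrite II0 image_set0 setI0 !act_set0 pmass0 mulr0.
rewrite IIS image_setU image_set1 setIUr.
have [Cn|Cn] := pselect (C (e n)); last first.
  suff -> : C `&` [set e n] = set0 by rewrite setU0.
  by apply/seteqP; split => // x [Cx xe]; apply: Cn; rewrite -xe.
have -> : C `&` [set e n] = [set e n] by apply: setIidr => _ ->.
exact: plunnecke_step.
Qed.

Lemma plunnecke_pow A (K : R) S : 0 <= K -> measurable S ->
  (forall S', measurable S' -> S' `<=` S -> excess A K S <= excess A K S') ->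
  forall k, p (sumset_pow A k ** S) <= K ^+ k * p S.
Proof.
move=> K0 mS minS; elim => [|k IH] /=.
  by rewrite act_set1 pmass_act// mul1r.
rewrite act_set_sumset// act_setC//.
apply: le_trans (plunnecke_petridis mS minS _) _.
by rewrite exprS -mulrA ler_wpM2l.
Qed.

End Plunnecke.

(** * Means *)

Section MeanTheory.
Context (G : zmodType) (R : realType) (l : {scalar (linf G R)})
  (hl : is_mean l).
Implicit Types (f h : linf G R) (C : set G).

Lemma linfBE f h x : (f - h) x = f x - h x.
Proof. by []. Qed.

Lemma linfDE f h x : (f + h) x = f x + h x.
Proof. by []. Qed.

Lemma linfZE (a : R) f x : (a *: f) x = a * f x.
Proof. by []. Qed.

Lemma le_mean f h : (forall x, f x <= h x) -> l f <= l h.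
Proof.
move=> fh; rewrite -subr_ge0 -linearB; apply: hl.1 => x.
by rewrite linfBE subr_ge0.
Qed.

Lemma mean_set_ge0 C : 0 <= mean_set l C.
Proof. by apply: hl.1 => x; rewrite /= indicE. Qed.

Lemma mean_setT_le1 : mean_set l [set: G] <= 1.
Proof.
rewrite -lee_fin -hl.2; apply: le_trans (ereal_sup_ubound _); last first.
  exists (linf_indic R [set: G]); last by [].
  apply: ge_sup; first by exists `|linf_indic R [set: G] 0|, 0.
  by move=> _ [x _ <-]; rewrite /= indicE in_setT normr1.
by rewrite lee_fin ler_norm.
Qed.

Lemma mean_setC C : mean_set l (~` C) = mean_set l [set: G] - mean_set l C.
Proof.
rewrite /mean_set -linearB; congr (l _); apply/val_inj/funext => x.
rewrite [RHS]linfBE /= !indicE in_setC in_setT.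
by case: (x \in C); rewrite ?subrr ?subr0.
Qed.

End MeanTheory.

(** By convention the supremum of the empty set is 0, which settles the case
    without invariant means here and in [upper_banach_density_le]. *)
Lemma upper_banach_density_ge0 (G : zmodType) (R : realType) (C : set G) :
  0 <= upper_banach_density R C.
Proof.
rewrite /upper_banach_density.
have [->|/set0P[_ [l hl _]]] :=
    eqVneq [set mean_set l C | l in @invariant_means G R] set0.
  by rewrite sup0.
apply: le_trans (mean_set_ge0 hl.1 C) _; apply: ub_le_sup; last by exists l.
exists 1 => _ [l' hl' <-]; apply: le_trans (mean_setT_le1 hl'.1).
apply: (le_mean hl'.1) => g; rewrite /= !indicE in_setT.
by rewrite ler_nat leq_b1.
Qed.

(** * Ergodicity along an invariant mean *)

Section Ergodic.
Context (R : realType) (G : zmodType) (d : measure_display)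
  (X : measurableType d) (P : probability X R) (act : G -> X -> X)
  (cG : countable [set: G]) (hact : is_gspace P act) (erg : ergodic P act).
Let act0 := gspace0 hact.
Let actD := gspaceD hact.
Local Notation p := (pmass P).
Context (l : {scalar (linf G R)}) (E : set X) (hl : invariant_means l)
  (mE : measurable E).
Let lT := mean_set l [set: G].

(** Boundedness is only known for measurable [S]; the default value 0 makes the
    definition total. *)
Definition overlap S : linf G R :=
  insubd (0 : linf G R) (fun g => p (act g @` S `&` E)).

Lemma overlapE S g : measurable S -> overlap S g = p (act g @` S `&` E).
Proof.
move=> mS; rewrite /overlap [linf_val _]insubdK//.
apply/bounded_predP; exists 1 => {}g; rewrite ger0_norm ?pmass_ge0//.
apply: pmass_le1; apply: measurableI => //.
exact: (act_image_measurable hact).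
Qed.

Definition mean_overlap S := l (overlap S).

Lemma mean_overlapUI S S' : measurable S -> measurable S' ->
  mean_overlap (S `|` S') + mean_overlap (S `&` S') =
  mean_overlap S + mean_overlap S'.
Proof.
move=> mS mS'; rewrite /mean_overlap -!linearD; congr (l _).
apply/val_inj/funext => g.
rewrite [LHS]linfDE [RHS]linfDE.
have mU := measurableU _ _ mS mS'; have mI := measurableI _ _ mS mS'.
have mg T : measurable T -> measurable (act g @` T `&` E).
  by move=> mT; apply: measurableI => //; exact: (act_image_measurable hact).
rewrite !overlapE//.
rewrite -[RHS]pmassUI; [|exact: mg|exact: mg].
rewrite image_setU setIUl setIACA setIid; congr (_ + p (_ `&` _)).
by rewrite !(act_imageE actD act0).
Qed.

Lemma mean_overlap_ge0 S : measurable S -> 0 <= mean_overlap S.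
Proof. by move=> mS; apply: hl.1.1 => g; rewrite overlapE// pmass_ge0. Qed.

Lemma le_mean_overlap S S' : measurable S -> measurable S' -> S `<=` S' ->
  mean_overlap S <= mean_overlap S'.
Proof.
move=> mS mS' SS'; apply: (le_mean hl.1) => g; rewrite !overlapE//.
apply: le_pmass; last by apply: setSI; exact: image_subset.
  by apply: measurableI => //; exact: (act_image_measurable hact).
by apply: measurableI => //; exact: (act_image_measurable hact).
Qed.

Lemma mean_overlap_le S : measurable S -> mean_overlap S <= p S * lT.
Proof.
move=> mS; rewrite /lT /mean_set -linearZ; apply: (le_mean hl.1) => g.
rewrite overlapE// linfZE /= indicT mulr1.
rewrite -(pmass_act hact g mS); apply: le_pmass.
- by apply: measurableI => //; exact: (act_image_measurable hact).
- exact: (act_image_measurable hact).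
- exact: subIsetl.
Qed.

Lemma mean_overlap_act g S : measurable S ->
  mean_overlap (act g @` S) = mean_overlap S.
Proof.
move=> mS; rewrite /mean_overlap -(hl.2 g (overlap S)); congr (l _).
apply/val_inj/funext => h /=; rewrite !overlapE//; last first.
  exact: (act_image_measurable hact).
congr (p (_ `&` _)); rewrite image_comp; apply: eq_imagel => x _ /=.
by rewrite addrC actD.
Qed.

Lemma mean_overlapT : mean_overlap [set: X] = p E * lT.
Proof.
rewrite /mean_overlap /lT /mean_set -linearZ; congr (l _).
apply/val_inj/funext => g; rewrite [LHS]overlapE//.
rewrite [RHS]linfZE /= indicT mulr1.
by rewrite (act_imageE actD act0) preimage_setT setTI.
Qed.

Lemma mean_overlap0 : mean_overlap set0 = 0.
Proof.
apply/eqP; rewrite eq_le mean_overlap_ge0// andbT.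
by apply: le_trans (mean_overlap_le measurable0) _; rewrite pmass0 mul0r.
Qed.

Definition discrepancy S := mean_overlap S - p E * lT * p S.

(** A mean is only finitely additive, but [mean_overlap] is dominated by a
    multiple of P ([mean_overlap_le]) and so inherits continuity from it. *)
Lemma discrepancy_submodular_lsc : submodular_lsc measurable discrepancy.
Proof.
have lT0 : 0 <= lT := mean_set_ge0 hl.1 setT.
split.
- by move=> S S'; exact: measurableU.
- by move=> S S'; exact: measurableI.
- move=> S S' mS mS'; have := pmassUI P mS mS'.
  have := mean_overlapUI mS mS'; rewrite /discrepancy => h1 h2.
  have -> : p (S `|` S') = p S + p S' - p (S `&` S') by lra.
  lra.
- move=> S b mS ndS hb; have mU := bigcupT_measurable _ mS.
  split=> //; set U := \bigcup_n S n in mU *.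
  have c1 : b + (p E * lT - lT) * (p (S n) - p U) @[n --> \oo] -->
      b + (p E * lT - lT) * (p U - p U).
    apply: cvgD; first exact: cvg_cst.
    apply: cvgMl_tmp; apply: cvgB; last exact: cvg_cst.
    exact: pmass_bigcup_cvg.
  rewrite subrr mulr0 addr0 in c1.
  apply: cvgr_to_ge c1 _; apply: nearW => n.
  have mD := measurableD mU (mS n).
  have SU : S n `<=` U by exact: bigcup_sup.
  have e1 := mean_overlapUI (mS n) mD; have e2 := pmassUI P (mS n) mD.
  have e3 := mean_overlap_le mD; have := hb n.
  rewrite setDIK (setDUK SU) mean_overlap0 pmass0 !addr0 in e1 e2.
  rewrite /discrepancy; nra.
- move=> S b mS niS hb; have mI := bigcapT_measurable mS.
  split=> //; set I := \bigcap_n S n in mI *.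
  rewrite /discrepancy lerBlDr.
  have c1 : b + p E * lT * p (S n) @[n --> \oo] --> b + p E * lT * p I.
    by apply: cvgD; [exact: cvg_cst|apply: cvgMl_tmp; exact: pmass_bigcap_cvg].
  apply: cvgr_to_ge c1 _; apply: nearW => n; rewrite -lerBlDr.
  apply: le_trans (hb n); rewrite /discrepancy lerD2r.
  by apply: le_mean_overlap => //; exact: bigcap_inf.
Qed.

Lemma discrepancy_act g S : measurable S ->
  discrepancy (act g @` S) = discrepancy S.
Proof.
by move=> mS; rewrite /discrepancy mean_overlap_act// (pmass_act hact).
Qed.

Lemma discrepancy_ge0_trivial S : measurable S -> p S = 0 \/ p S = 1 ->
  0 <= discrepancy S.
Proof.
move=> mS [pS|pS]; rewrite /discrepancy pS ?mulr0 ?subr0 ?mulr1.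
  exact: mean_overlap_ge0.
have := mean_overlapUI mS (measurableC mS).
have := mean_overlap_le (measurableC mS).
rewrite pmassC// pS setUv setICr mean_overlapT mean_overlap0; lra.
Qed.

(** Half of the mean ergodic theorem, with l in place of ergodic averages. The
    union T of the translates of a minimizer of the discrepancy is a minimizer
    and is invariant, so that P T is 0 or 1 and the minimum is nonnegative. *)
Lemma mean_overlap_ge S : measurable S -> p E * lT * p S <= mean_overlap S.
Proof.
rewrite -subr_ge0 -/(discrepancy S).
have lT0 : 0 <= lT := mean_set_ge0 hl.1 setT.
have [||S0 mS0 minS0] := submodular_min discrepancy_submodular_lsc.
- by exists set0.
- exists (- (p E * lT)) => S' mS'; rewrite /discrepancy.
  have := mean_overlap_ge0 mS'; have := pmass_le1 P mS'.
  have : 0 <= p E * lT by rewrite mulr_ge0// pmass_ge0.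
  nra.
move=> mS; apply: le_trans (minS0 _ mS).
have [e he] := countable_enumeration 0 cG.
pose T := \bigcup_n (act (e n) @` S0).
have [mT Tle] : measurable T /\ discrepancy T <= discrepancy S0 + 0.
  apply: (near_minimizer_bigcup discrepancy_submodular_lsc
    (e := fun=> 0)) => // [n|n|n].
  - exact: (act_image_measurable hact).
  - by rewrite discrepancy_act// addr0.
  - by rewrite big1.
rewrite addr0 in Tle; apply: le_trans Tle; apply: discrepancy_ge0_trivial => //.
have invT g : act g @` T = T.
  have sub h : act h @` T `<=` T.
    move=> _ [_ [n _ [x S0x <-]] <-]; have [m em] := he (h + e n).
    by exists m => //; exists x; rewrite // em actD.
  apply/seteqP; split; first exact: sub.
  move=> x Tx; exists (act (- g) x); last by rewrite -actD subrr act0.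
  by apply: (sub (- g)); exists x.
apply: contrapT => /not_orP[T0 T1]; apply: erg; exists T; split=> //.
rewrite pmassE// !lte_fin !lt_neqAle pmass_ge0 pmass_le1// !andbT eq_sym.
by apply/andP; split; apply/eqP.
Qed.

End Ergodic.

(** * Density and product sets *)

Section Density.
Context (R : realType) (G : zmodType) (d : measure_display)
  (X : measurableType d) (P : probability X R) (act : G -> X -> X)
  (cG : countable [set: G]) (hact : is_gspace P act) (erg : ergodic P act).
Local Notation p := (pmass P).

(** With E the complement of C S, the function g |-> P (g S inter E) vanishes on
    C and is at most P S elsewhere, so its mean is at most P S times the mean of
    the complement of C; [mean_overlap_ge] bounds the same mean from below. *)
Lemma mean_set_le_act (l : {scalar (linf G R)}) C S : invariant_means l ->
  measurable S -> 0 < p S -> mean_set l C <= p (act_set act C S).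
Proof.
move=> hl mS pS; have mD := act_set_measurable cG hact C mS.
have mE := measurableC mD; set E := ~` _ in mE.
have := mean_overlap_ge cG hact erg hl mE mS.
have : mean_overlap P act l E S <= p S * mean_set l (~` C).
  rewrite /mean_set -linearZ; apply: (le_mean hl.1) => g.
  rewrite overlapE// linfZE /= indicE in_setC.
  have [gC|gC] := boolP (g \in C).
    rewrite mulr0 (_ : _ `&` _ = set0) ?pmass0//.
    apply/seteqP; split => // x [gSx]; apply.
    by exists g => //; rewrite inE in gC.
  rewrite mulr1 -(pmass_act hact g mS); apply: le_pmass.
  - by apply: measurableI => //; exact: (act_image_measurable hact).
  - exact: (act_image_measurable hact).
  - exact: subIsetl.
rewrite mean_setC pmassC//.
have := mean_setT_le1 hl.1; have := pmass_ge0 P (act_set act C S).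
set a := p (act_set _ _ _); set b := p S; set lT := mean_set l setT.
set lC := mean_set l C => a0 lT1 h1 h2.
have : b * ((1 - a) * lT) <= b * (lT - lC) by lra.
rewrite ler_pM2l//; nra.
Qed.

Lemma upper_banach_density_le C S : measurable S -> 0 < p S ->
  upper_banach_density R C <= p (act_set act C S).
Proof.
move=> mS pS; rewrite /upper_banach_density.
have [->|/set0P ne] :=
    eqVneq [set mean_set l C | l in @invariant_means G R] set0.
  by rewrite sup0 pmass_ge0.
by apply: ge_sup => // _ [l hl <-]; exact: mean_set_le_act.
Qed.

End Density.

(** * The theorem *)

Theorem theorem1p2 (R : realType) (G : zmodType) (d : measure_display)
    (X : measurableType d) (P : probability X R) (act : G -> X -> X)
    (A : set G) (B : set X)
    (G_countable : countable [set: G])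
    (act_gspace : is_gspace P act)
    (act_ergodic : ergodic P act)
    (B_measurable : measurable B)
    (B_pos : (0 < P B)%E) :
  (forall K : R, (P (act_set act A B) <= K%:E * P B)%E ->
    forall k : nat, (1 <= k)%N ->
      ((upper_banach_density R (sumset_pow A k))%:E <= (K ^+ k)%:E * P B)%E)
  /\
  (forall k : nat, (1 <= k)%N ->
    ((upper_banach_density R (sumset_pow A k) `^ (k%:R^-1))%:E
       * P B `^ (1 - k%:R^-1) <= P (act_set act A B))%E).
Proof.
have mAB := act_set_measurable G_countable act_gspace A B_measurable.
have pB : 0 < pmass P B by rewrite -lte_fin -pmassE.
have first K : pmass P (act_set act A B) <= K * pmass P B -> forall k : nat,
    upper_banach_density R (sumset_pow A k) <= K ^+ k * pmass P B.
  move=> hK k.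
  have K0 : 0 <= K.
    by rewrite -(pmulr_lge0 _ pB); apply: le_trans hK; exact: pmass_ge0.
  have [S [mS SB pS minS]] := exists_excess_minimizer G_countable act_gspace
    K0 B_measurable pB hK.
  apply: le_trans (upper_banach_density_le G_countable act_gspace act_ergodic
    (sumset_pow A k) mS pS) _.
  apply: le_trans (plunnecke_pow G_countable act_gspace K0 mS _ k) _.
    by move=> S' mS' S'S; apply: minS => //; exact: subset_trans SB.
  by rewrite ler_wpM2l ?exprn_ge0// le_pmass.
split=> [K|k k1]; rewrite !pmassE//.
  by move=> hK k _; rewrite -EFinM lee_fin; apply: first.
set p := pmass P B in pB *; set q := pmass P _.
have q0 : 0 <= q := pmass_ge0 P _.
set D := upper_banach_density R _.
have D0 : 0 <= D := upper_banach_density_ge0 R _.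
have hD : D <= (q / p) ^+ k * p by apply: first; rewrite divfK ?gt_eqF.
have k0 : k%:R != 0 :> R by rewrite pnatr_eq0 -lt0n.
rewrite poweR_EFin -EFinM lee_fin.
(* The exponents of p add up to 1, and the k-th root of (q / p)^k is q / p. *)
have -> : q = ((q / p) ^+ k * p) `^ k%:R^-1 * p `^ (1 - k%:R^-1).
  rewrite powRM ?exprn_ge0 ?divr_ge0 ?(ltW pB)// -powR_mulrn ?divr_ge0 ?(ltW pB)//.
  rewrite -powRrM mulfV// powRr1 ?divr_ge0 ?(ltW pB)// -mulrA -powRD.
    by rewrite addrC subrK powRr1 ?(ltW pB)// divfK ?gt_eqF.
  by apply/implyP => _; rewrite gt_eqF.
rewrite ler_wpM2r ?powR_ge0// ge0_ler_powR ?invr_ge0// nnegrE.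
by rewrite mulr_ge0 ?exprn_ge0 ?divr_ge0 ?(ltW pB).
Qed.
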